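(* Let $q$ be a power of a prime and let $F=\mathbb{F}_q(t)$ with $t$ transcendental over $\mathbb{F}_q$. Then the polynomial $x^{q^2-1}+tx^{q-1}+1\in F[x]$ has Galois group over $F$ isomorphic to $SL(2,q)$. *)

(* Defs.v *)
From HB Require Import structures.
From mathcomp Require Import all_boot all_order all_fingroup all_algebra all_field.
Set Implicit Arguments. Unset Strict Implicit. Unset Printing Implicit Defensive.
Import GRing.Theory.
Local Open Scope ring_scope.

Notation ratfun K := {fraction {poly K}}.

Definition tvar (K : finFieldType) : ratfun K := tofrac ('X : {poly K}).

Definition pol72 (K : finFieldType) : {poly ratfun K} :=
  'X^(#|K| ^ 2 - 1) + (tvar K)%:P * 'X^(#|K| - 1) + 1.

Definition SL2 (K : finFieldType) : {set {'GL_2[K]}} :=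
  [set g : {'GL_2[K]} | \det (GLval g) == 1].

(* Main.v *)
Require Import Defs.
From HB Require Import structures.
From mathcomp Require Import all_boot all_order all_fingroup all_algebra all_field.
Local Open Scope ring_scope.

From mathcomp Require Import ring.
Set Implicit Arguments. Unset Strict Implicit. Unset Printing Implicit Defensive.
Import GRing.Theory.

(** Multiplying the trinomial by x gives the additive polynomial
    P = x^(q^2) + t x^q + x, whose roots form a plane V over F_q.  The form
    W(u, v) = u v^q - u^q v satisfies W^q = W on V, hence is F_q-valued; it is a
    determinant on V and is fixed by the Galois group G, so G embeds in SL(2, q).
    Choose a basis x, y of V with W(x, y) = 1.
    - G is transitive on nonzero vectors: the trinomial A + t B, where
      A = X^(q^2-1) + 1 and B = X^(q-1) are coprime, is linear in t, hence
      irreducible.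
    - F(x) = F_q(x), and z = y / x satisfies z^q - z = (1/x)^(q+1).  The stabilizer
      of x acts by z |-> z + a with a in a subgroup H of F_q.  The additive
      polynomial D = prod_(a in H) (X - a) gives N = D(z) in F_q(x) with
      N^q - N = D((1/x)^(q+1)); comparing degrees in 1/x shows that q divides
      #|H| (q + 1), so H = F_q and the stabilizer contains all transvections
      y |-> y + a x.
    These two facts together give all of SL(2, q). *)

(** * The Moore form and additive polynomials *)

Section Moore.

Variables (K : finFieldType) (L : fieldType) (iota : {rmorphism K -> L}).
Local Notation q := #|K|.

Lemma card_pchar_nat : [pchar L]%R.-nat q.
Proof.
have [p p_pr pK] := finPcharP K.
rewrite (card_pprimeChar pK).
by rewrite pnatX pnatE // (rmorph_pchar iota pK).
Qed.

Lemma natr_card : q%:R = 0 :> L.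
Proof.
apply/eqP; have pL : pdiv q \in [pchar L].
  by rewrite (pnatPpi card_pchar_nat) ?pi_pdiv ?finNzRing_gt1.
by rewrite -(dvdn_pcharf pL) pdiv_dvd.
Qed.

Lemma expr_cardD (u v : L) : (u + v) ^+ q = u ^+ q + v ^+ q.
Proof. exact: exprDn_pchar card_pchar_nat. Qed.

Lemma expr_cardN (u : L) : (- u) ^+ q = - u ^+ q.
Proof.
apply/eqP; rewrite -addr_eq0 -expr_cardD addNr expr0n.
by rewrite gtn_eqF // ltnW // finNzRing_gt1.
Qed.

Lemma expr_card_iota a : iota a ^+ q = iota a.
Proof. by rewrite -rmorphXn expf_card. Qed.

(** X^q - X already splits over [K] into the factors X - a, so it has no further roots in [L]. *)
Lemma expr_card_fixed (v : L) : v ^+ q = v -> exists a, v = iota a.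
Proof.
move=> vq; have : root (map_poly iota ('X^q - 'X)) v.
  by rewrite rmorphB /= map_polyXn map_polyX rootE !hornerE vq subrr.
rewrite finField_genPoly rmorph_prod rootE horner_prod prodf_seq_eq0.
case/hasP=> a _ /=; rewrite rmorphB /= map_polyX map_polyC /= !hornerE subr_eq0.
by move/eqP->; exists a.
Qed.

(** The 2 x 2 Moore determinant, an alternating form that is bilinear over F_q. *)
Definition moore (u v : L) := u * v ^+ q - u ^+ q * v.

Lemma moore_lin u a b v w :
  moore u (iota a * v + iota b * w) = iota a * moore u v + iota b * moore u w.
Proof. by rewrite /moore expr_cardD !exprMn !expr_card_iota; ring. Qed.

Lemma moorexx u : moore u u = 0.
Proof. by rewrite /moore mulrC subrr. Qed.

Lemma moore1_neq0 u v : moore u v = 1 -> u != 0.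
Proof.
move=> uv; apply: contraTneq (oner_neq0 L) => u0; rewrite -uv u0 /moore.
by rewrite mul0r expr0n gtn_eqF ?mul0r ?subrr ?eqxx // ltnW // finNzRing_gt1.
Qed.

(** The vanishing says that v / u is fixed by the q-th power map. *)
Lemma moore_eq0 u v : u != 0 -> moore u v = 0 -> exists a, v = iota a * u.
Proof.
move=> u0 /eqP; rewrite subr_eq0 => /eqP uv.
have [|a av] := @expr_card_fixed (v / u).
  have uq0 : u ^+ q != 0 by rewrite expf_neq0.
  by rewrite expr_div_n; apply/eqP; rewrite eqr_div // mulrC uv mulrC.
by exists a; rewrite -av divfK.
Qed.

Lemma moore_det x y a b c d :
  moore (iota a * x + iota b * y) (iota c * x + iota d * y) =
  iota (a * d - b * c) * moore x y.
Proof.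
rewrite /moore !expr_cardD !exprMn !expr_card_iota rmorphB !rmorphM.
by ring.
Qed.

Lemma moore_coord_inj x y a b c d : moore x y = 1 ->
  iota a * x + iota b * y = iota c * x + iota d * y -> a = c /\ b = d.
Proof.
move=> xy e; have x0 := moore1_neq0 xy.
have bd : b = d.
  have := congr1 (moore x) e.
  by rewrite !moore_lin moorexx !mulr0 !add0r xy !mulr1 => /fmorph_inj.
split=> //; move: e; rewrite bd => /addIr /(mulIf x0); exact: fmorph_inj.
Qed.

Definition dickson (t v : L) : L := v ^+ q ^+ q + t * v ^+ q + v.
Definition dickson_root (t v : L) := dickson t v = 0.

Lemma dickson_root_lin t a b v w : dickson_root t v -> dickson_root t w ->
  dickson_root t (iota a * v + iota b * w).
Proof.
rewrite /dickson_root /dickson !expr_cardD !exprMn !expr_card_iota.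
move=> tv tw; transitivity (iota a * (v ^+ q ^+ q + t * v ^+ q + v) +
  iota b * (w ^+ q ^+ q + t * w ^+ q + w)); first by ring.
by rewrite tv tw !mulr0 addr0.
Qed.

(** Substituting u^(q^2) = -(t u^q + u), and likewise for v, into W(u, v)^q cancels the terms in t
    and leaves W(u, v). *)
Lemma moore_dickson t u v : dickson_root t u -> dickson_root t v ->
  exists a, moore u v = iota a.
Proof.
move=> tu tv; apply: expr_card_fixed.
have sub w : dickson_root t w -> w ^+ q ^+ q = - (t * w ^+ q + w).
  by rewrite /dickson_root /dickson -addrA => /eqP; rewrite addr_eq0 => /eqP.
rewrite {1}/moore expr_cardD expr_cardN !exprMn (sub u tu) (sub v tv) /moore.
by ring.
Qed.

(** With b = W(x, v), the form W(x, v - b y) vanishes, so v - b y is a multiple of x. *)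
Lemma dickson_span t x y v : moore x y = 1 ->
  dickson_root t x -> dickson_root t y -> dickson_root t v ->
  exists a b, v = iota a * x + iota b * y.
Proof.
move=> xy tx ty tv; have x0 := moore1_neq0 xy.
have [b xv] := moore_dickson tx tv.
have [|a va] := @moore_eq0 x (iota 1 * v + iota (- b) * y) x0.
  by rewrite moore_lin xy xv rmorph1 rmorphN; ring.
exists a, b; rewrite -va rmorph1 rmorphN; ring.
Qed.

End Moore.

(** * Rational functions in one element *)

Section Evaluation.

Variables (K L : fieldType) (iota : {rmorphism K -> L}).
Local Notation ev u := (horner_morph (fun a => mulrC u (iota a))).

Definition transcendental (u : L) := forall p : {poly K}, ev u p = 0 -> p = 0.

Lemma not_algebraic_transcendental u :
  ~ algebraicOver iota u -> transcendental u.
Proof.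
move=> alg p pu0; apply/eqP/negP => /negP p0; case: alg.
by exists p => //; apply/rootP.
Qed.

Lemma transcendental_not_algebraic u :
  transcendental u -> ~ algebraicOver iota u.
Proof. by move=> tr [p p0 /rootP /tr p00]; rewrite p00 eqxx in p0. Qed.

(** This turns a relation for x over K[t] into a relation for t over K[x]. *)
Lemma horner_map_swapXY (h : {poly {poly K}}) x t :
  (map_poly (ev t) h).[x] = (map_poly (ev x) (swapXY h)).[t].
Proof.
have evE u (g : {poly {poly K}}) :
    map_poly (ev u) g = map_poly (horner_eval u) (map_poly (map_poly iota) g).
  by rewrite -map_poly_comp.
by rewrite !evE -swapXY_map -horner_polyC -horner_swapXY horner2_swapXY.
Qed.

Section LinearRelation.

Variables (x t : L) (A B : {poly K}).
Hypotheses (x_tr : transcendental x) (t0 : t != 0).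
Hypotheses (coAB : coprimep A B) (tAB : ev x A + t * ev x B = 0).

Lemma horner_clear_denom (u : {poly {poly K}}) :
  exists m S, (map_poly (ev x) u).[t] * ev x B ^+ m = ev x S.
Proof.
elim/poly_ind: u => [|u c [m [S uS]]].
  by exists 0%N, 0; rewrite !rmorph0 horner0 mul0r.
(* Of the m + 1 factors B, one turns the new factor t into -A and the other m clear u. *)
exists m.+1, (c * B ^+ m.+1 - S * A); rewrite rmorphB !rmorphM rmorphXn /= -uS.
rewrite rmorphD rmorphM /= map_polyX map_polyC !hornerE.
have -> : ev x A = - (t * ev x B) by apply/eqP; rewrite -addr_eq0 tAB.
by rewrite exprS; ring.
Qed.

(* Read as a polynomial in t over K[x], a relation has a constant term c which A
   divides, so the degree bound forces c = 0 and t can be factored out. *)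
Lemma linear_relation_free (u : {poly {poly K}}) :
  (forall i, (size (u`_i)%R < size A)%N) -> (map_poly (ev x) u).[t] = 0 -> u = 0.
Proof.
elim/poly_ind: u => [//|u c IH] su; rewrite rmorphD rmorphM /= map_polyX map_polyC.
rewrite !hornerE => ut.
have [m [S uS]] := horner_clear_denom u.
have dvdA : A %| c * B ^+ m.+1.
  apply/dvdpP; exists S; apply/eqP; rewrite -subr_eq0; apply/eqP/x_tr.
  rewrite rmorphB !rmorphM rmorphXn /= -uS.
  have -> : ev x A = - (t * ev x B) by apply/eqP; rewrite -addr_eq0 tAB.
  transitivity (((map_poly (ev x) u).[t] * t + ev x c) * ev x B ^+ m.+1).
    by rewrite exprS; ring.
  by rewrite ut mul0r.
have c0 : c = 0.
  apply/eqP/negP => /negP c0; rewrite Gauss_dvdpl ?coprimep_expr // in dvdA.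
  move: (dvdp_leq c0 dvdA); rewrite leqNgt => /negP; apply.
  by have := su 0; rewrite coefD coefMX coefC eqxx add0r.
suff -> : u = 0 by rewrite c0 mul0r addr0.
apply: IH => [i|].
  by have := su i.+1; rewrite coefD coefMX coefC /= addr0.
move: ut; rewrite c0 raddf0 addr0 => /eqP; rewrite mulf_eq0 (negPf t0) orbF.
by move/eqP.
Qed.

End LinearRelation.

(** Membership in the subfield K(u), as a predicate on elements of [L]; the closure properties
    follow. *)
Definition rational_in (u e : L) :=
  exists A B : {poly K}, ev u B != 0 /\ e = ev u A / ev u B.

Lemma rational_in_eval u p : rational_in u (ev u p).
Proof. by exists p, 1; rewrite rmorph1 oner_neq0 divr1. Qed.

Lemma rational_inD u e f :
  rational_in u e -> rational_in u f -> rational_in u (e + f).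
Proof.
move=> [A [B [B0 ->]]] [C [D [D0 ->]]]; exists (A * D + C * B), (B * D).
by rewrite rmorphD !rmorphM /= mulf_neq0 // addf_div.
Qed.

Lemma rational_inM u e f :
  rational_in u e -> rational_in u f -> rational_in u (e * f).
Proof.
move=> [A [B [B0 ->]]] [C [D [D0 ->]]]; exists (A * C), (B * D).
by rewrite !rmorphM /= mulf_neq0 // mulf_div.
Qed.

Lemma rational_inV u e : rational_in u e -> rational_in u e^-1.
Proof.
move=> [A [B [B0 ->]]]; have [A0|A0] := eqVneq (ev u A) 0.
  by rewrite A0 mul0r invr0 -(rmorph0 (ev u)); apply: rational_in_eval.
by exists B, A; rewrite invf_div.
Qed.

Lemma rational_inX u e n : rational_in u e -> rational_in u (e ^+ n).
Proof.
move=> eu; elim: n => [|n IH]; last by rewrite exprS; apply: rational_inM.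
by rewrite expr0 -(rmorph1 (ev u)); apply: rational_in_eval.
Qed.

Lemma rational_in_horner u (p : {poly L}) x :
  (forall i, rational_in u p`_i) -> rational_in u x -> rational_in u p.[x].
Proof.
move=> pu xu; rewrite horner_coef; elim/big_ind: _ => [|e f|i _].
- by rewrite -(rmorph0 (ev u)); apply: rational_in_eval.
- exact: rational_inD.
- by apply: rational_inM => //; apply: rational_inX.
Qed.

Lemma rational_in_comp u x p : rational_in u x -> rational_in u (ev x p).
Proof.
move=> xu; apply: rational_in_horner => // i; rewrite coef_map /=.
by exists (p`_i)%:P, 1; rewrite rmorph1 oner_neq0 divr1 horner_morphC.
Qed.

End Evaluation.

(** * Fractions and common denominators *)

Section Fraction.

Variable R : idomainType.

Lemma fractionP (e : {fraction R}) :
  exists a b : R, b != 0 /\ e = tofrac a / tofrac b.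
Proof.
elim/quotW: e => r; exists \n_r, \d_r; split; first exact: denom_ratioP.
apply: (canRL (mulfK _)); first by rewrite tofrac_eq0 denom_ratioP.
unlock tofrac; rewrite -[LHS]FracField.pi_mul /FracField.mulf.
rewrite !numden_Ratio ?oner_neq0 // mulr1; apply/eqmodP.
by rewrite /= FracField.equivfE !numden_Ratio ?oner_neq0 ?denom_ratioP // mulr1 mulrC.
Qed.

Lemma poly_common_denom (p : {poly {fraction R}}) :
  exists (d : R) (h : {poly R}), d != 0 /\ tofrac d *: p = map_poly (@tofrac R) h.
Proof.
elim/poly_ind: p => [|p c [d [h [d0 dp]]]].
  by exists 1, 0; rewrite oner_neq0 scaler0 rmorph0.
have [a [b [b0 ->]]] := fractionP c.
exists (d * b), (b *: h * 'X + (d * a)%:P); rewrite mulf_neq0 //; split=> //.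
rewrite [RHS]rmorphD [in RHS]rmorphM /= map_polyX map_polyC /= map_polyZ /= -dp.
rewrite scalerDr scalerAl scalerA [tofrac (d * b)]tofracM [in RHS]tofracM.
rewrite [tofrac b * _]mulrC -(mul_polyC (_ * _) _%:P) -polyCM mulrACA.
have nb : tofrac b != 0 by rewrite tofrac_eq0.
by rewrite (divff nb) mulr1.
Qed.

End Fraction.

Definition const_in (K : fieldType) (L : fieldType) (j : {rmorphism ratfun K -> L}) :
  {rmorphism K -> L} := j \o (@tofrac {poly K}) \o polyC.

Section RationalFunctions.

Variables (K : finFieldType) (L : fieldType) (j : {rmorphism ratfun K -> L}).
Local Notation q := #|K|.
Local Notation iota := (const_in j).
Local Notation ev u := (horner_morph (fun a => mulrC u (iota a))).
Local Notation t := (j (tvar K)).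

Lemma ev_tvar (p : {poly K}) : ev t p = j (tofrac p).
Proof. exact/esym/(poly_initial (j \o @tofrac {poly K})). Qed.

Lemma tvar_transcendental : transcendental iota t.
Proof.
move=> p /eqP; rewrite ev_tvar fmorph_eq0 tofrac_eq0 => /eqP; exact.
Qed.

Lemma rational_in_ratfun u : rational_in iota u t ->
  forall e : ratfun K, rational_in iota u (j e).
Proof.
move=> tu e; have [a [b [b0 ->]]] := fractionP e.
rewrite fmorph_div -(ev_tvar a) -(ev_tvar b).
by apply: rational_inM; last apply: rational_inV; apply: rational_in_comp.
Qed.

(** Bounds below the degree of x over F_q(t). After clearing denominators, p(x) = 0 is read as a
    relation for t over K[x] whose coefficients have degree at most that of p; if this were below
    deg A, the relation would be trivial. *)
Lemma root_size_ge x (A B : {poly K}) (p : {poly ratfun K}) :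
  transcendental iota x -> coprimep A B -> ev x A + t * ev x B = 0 ->
  p != 0 -> root (map_poly j p) x -> (size A <= size p)%N.
Proof.
move=> x_tr coAB tAB p0 px; rewrite leqNgt; apply/negP => sp.
have [d [h [d0 dp]]] := poly_common_denom p.
have d0' : tofrac d != 0 by rewrite tofrac_eq0.
have sh : size h = size p.
  by rewrite -(size_scale p d0') dp size_map_inj_poly // => a b /eqP;
     rewrite tofrac_eq => /eqP.
have h0 : h != 0 by rewrite -size_poly_eq0 sh size_poly_eq0.
have t0 : t != 0.
  by rewrite fmorph_eq0 tofrac_eq0 polyX_eq0.
have hx : (map_poly (ev t) h).[x] = 0.
  have -> : map_poly (ev t) h = map_poly j (tofrac d *: p).
    by rewrite dp -map_poly_comp; apply: eq_map_poly => c; exact: ev_tvar.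
  by rewrite map_polyZ hornerZ (rootP px) mulr0.
rewrite horner_map_swapXY in hx.
case/negP: h0; rewrite -swapXY_eq0; apply/eqP.
apply: (linear_relation_free x_tr t0 coAB tAB) hx => i.
apply: leq_ltn_trans sp; rewrite -sh; apply/leq_sizeP => k hk.
by rewrite coef_swapXY (nth_default _ hk) coef0.
Qed.

End RationalFunctions.

(** * Artin-Schreier equations over a rational function field *)

Section ArtinSchreier.

Variables (K : finFieldType) (L : fieldType) (iota : {rmorphism K -> L}).
Local Notation q := #|K|.
Local Notation ev u := (horner_morph (fun a => mulrC u (iota a))).

Lemma size_sub_monic (p r : {poly L}) n : p \is monic -> r \is monic ->
  size p = n.+1 -> size r = n.+1 -> (size (p - r)%R <= n)%N.
Proof.
move=> /monicP pm /monicP rm sp sr; apply/leq_sizeP => k.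
rewrite leq_eqVlt coefB => /orP[/eqP<-|nk].
  by move: pm rm; rewrite /lead_coef sp sr /= => -> ->; rewrite subrr.
by rewrite !nth_default ?subrr ?sp ?sr.
Qed.

(** * The additive polynomial of a subgroup of F_q *)

Section SubgroupPolynomial.

Variables (H : {set K}) (H_zmod : zmod_closed H).

Lemma subgroup_prod_translate (u : L) b : b \in H ->
  \prod_(a in H) (u + iota b - iota a) = \prod_(a in H) (u - iota a).
Proof.
have [H0 HB] := H_zmod => Hb.
have HD a c : a \in H -> c \in H -> a + c \in H.
  by move=> Ha Hc; rewrite -[c]opprK -[- c]sub0r HB ?HB.
rewrite (reindex_inj (addIr b)) /=; apply: eq_big => [a|a _].
  apply/idP/idP => Ha; last exact: HD.
  by rewrite -[a](addrK b) HB.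
by rewrite rmorphD; ring.
Qed.

(** With D the product of the X - a, the difference D(X + v) - D(X) - D(v) has degree below #|H|, as
    the leading terms cancel, and it vanishes on H by translation invariance. *)
Lemma subgroup_prod_additive (u v : L) :
  \prod_(a in H) (u + v - iota a) =
    \prod_(a in H) (u - iota a) + \prod_(a in H) (v - iota a).
Proof.
have [H0 _] := H_zmod.
pose P w : {poly L} := \prod_(a in H) ('X - (iota a - w)%:P).
have PE w x : (P w).[x] = \prod_(a in H) (x + w - iota a).
  by rewrite horner_prod; apply: eq_bigr => a _; rewrite !hornerE; ring.
have Ps w : size (P w) = #|H|.+1.
  by rewrite /P -big_enum size_prod_XsubC /= -cardE.
have Pm w : P w \is monic by exact: monic_prod_XsubC.
pose Q := P v - P 0 - ((P v).[0])%:P.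
suff Q0 : Q = 0.
  have : Q.[u] = 0 by rewrite Q0 horner0.
  rewrite !hornerE !PE add0r addr0 => /eqP; rewrite subr_eq0 => /eqP <-.
  by rewrite [RHS]addrC subrK.
apply: (@roots_geq_poly_eq0 _ _ [seq iota a | a <- enum H]).
- apply/allP => _ /mapP[a Ha ->]; rewrite mem_enum in Ha.
  rewrite rootE !hornerE !PE add0r addr0 [iota a + v]addrC.
  have -> : \prod_(c in H) (iota a - iota c) = 0.
    by rewrite (bigD1 a) //= subrr mul0r.
  by rewrite subgroup_prod_translate // subr0 subrr.
- by rewrite map_inj_uniq ?enum_uniq //; apply: fmorph_inj.
rewrite size_map -cardE; apply: leq_trans (size_polyD _ _) _.
rewrite geq_max size_sub_monic //= size_polyN size_polyC.
(* The constant has size at most 1, which is within the bound because H contains 0. *)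
by apply: leq_trans (leq_b1 _) _; apply/card_gt0P; exists 0.
Qed.

End SubgroupPolynomial.

(* A pole of N of order d at u = infinity is a pole of order q d of N^q - N. *)
Lemma rational_artin_schreier_degree (u N : L) (S : {poly K}) :
  transcendental iota u -> rational_in iota u N -> N ^+ q - N = ev u S ->
  (q %| (size S).-1)%N.
Proof.
move=> u_tr [A [B [B0 ->]]] NS.
have q0 : (0 < q)%N := ltnW (finNzRing_gt1 K).
have [s1|s1] := leqP (size S).-1 0%N.
  by move: s1; rewrite leqn0 => /eqP ->; rewrite dvdn0.
have S0 : S != 0 by apply: contraTneq s1 => ->; rewrite size_poly0.
have nzB : B != 0 by apply: contraNneq B0 => ->; rewrite rmorph0.
have AB : A ^+ q - A * B ^+ q.-1 = B ^+ q * S.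
  apply/eqP; rewrite -subr_eq0; apply/eqP/u_tr.
  rewrite !rmorphB !rmorphM !rmorphXn /= -NS expr_div_n.
  have -> : ev u B ^+ q.-1 = ev u B ^+ q / ev u B.
    by rewrite -{2}(prednK q0) exprSr mulfK.
  have Bq0 : ev u B ^+ q != 0 by rewrite expf_neq0.
  by field; rewrite B0 Bq0.
have nzA : A != 0.
  apply: contraTneq S0 => A0; move/eqP: AB.
  rewrite A0 mul0r expr0n gtn_eqF // subr0 eq_sym mulf_eq0 expf_eq0 q0.
  by rewrite (negPf nzB) negbK.
have sX (P : {poly K}) n : P != 0 -> size (P ^+ n) = ((size P).-1 * n).+1.
  move=> P0; rewrite -size_exp prednK // size_poly_gt0 expf_neq0 //.
have pS (P : {poly K}) : P != 0 -> size P = (size P).-1.+1.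
  by move=> P0; rewrite prednK // size_poly_gt0.
have sR : size (B ^+ q * S) = ((size B).-1 * q + (size S).-1).+1.
  rewrite size_mul ?expf_neq0 // sX // {1}(pS S S0) /=.
  by rewrite addnS.
have sM : size (A * B ^+ q.-1) = ((size A).-1 + (size B).-1 * q.-1).+1.
  rewrite size_mul ?expf_neq0 // sX // {1}(pS A nzA).
  by rewrite addnS.
(* Without a pole at infinity the left side of [AB] has degree at most q deg B, which contradicts
   deg S > 0. With a pole A^q dominates, so q deg A = q deg B + deg S. *)
have [ab|ab] := leqP (size A).-1 (size B).-1.
  have : (size (A ^+ q - A * B ^+ q.-1)%R <= ((size B).-1 * q).+1)%N.
    apply: leq_trans (size_polyD _ _) _; rewrite size_polyN geq_max sM sX //.
    rewrite !ltnS leq_mul2r ab orbT /=.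
    by rewrite -{2}(prednK q0) mulnS leq_add2r.
  rewrite AB sR ltnS -{2}[(_ * _)%N]addn0 leq_add2l leqNgt.
  by rewrite s1.
have : size (A ^+ q - A * B ^+ q.-1) = ((size A).-1 * q).+1.
  rewrite size_polyDl sX // size_polyN sM ltnS.
  rewrite -{2}(prednK q0) mulnS ltn_add2l ltn_pmul2r //.
  by rewrite -ltnS prednK // finNzRing_gt1.
rewrite AB sR => -[] e.
rewrite -(dvdn_addr _ (dvdn_mull (size B).-1 (dvdnn q))) e.
exact: dvdn_mull.
Qed.

Lemma artin_schreier_subgroup (H : {set K}) (u z : L) :
  transcendental iota u -> zmod_closed H -> z ^+ q - z = u ^+ q.+1 ->
  rational_in iota u (\prod_(a in H) (z - iota a)) -> H = setT.
Proof.
move=> u_tr H_zmod zu rN.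
pose D : {poly K} := \prod_(a in H) ('X - a%:P).
have NS : (\prod_(a in H) (z - iota a)) ^+ q - \prod_(a in H) (z - iota a)
    = ev u (D \Po 'X^(q.+1)).
  (* The q-th power fixes the constants a, so D(z)^q = D(z^q), and z^q = z + u^(q+1); additivity
     then leaves D(u^(q+1)). *)
  have -> : (\prod_(a in H) (z - iota a)) ^+ q
      = \prod_(a in H) (z + u ^+ q.+1 - iota a).
    rewrite -prodrXl; apply: eq_bigr => a _.
    rewrite (expr_cardD iota) (expr_cardN iota) expr_card_iota.
    by rewrite -zu; ring.
  rewrite subgroup_prod_additive // addrC addKr.
  rewrite rmorph_prod rmorph_prod; apply: eq_bigr => a _.
  rewrite /= comp_polyB comp_polyX comp_polyC rmorphB rmorphXn /=.
  by rewrite horner_morphX horner_morphC.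
have := rational_artin_schreier_degree u_tr rN NS.
rewrite size_comp_poly size_polyXn /= {1}/D -big_enum size_prod_XsubC /= -cardE.
(* The degree is #|H| (q + 1), and q is coprime to q + 1. *)
rewrite Gauss_dvdl ?coprimenS // => qH.
apply/eqP; rewrite eqEcard subsetT cardsT dvdn_leq //.
by apply/card_gt0P; exists 0; case: H_zmod.
Qed.

End ArtinSchreier.

(** * The roots of the trinomial *)

Section TrinomialRoots.

Variables (K : finFieldType) (L : fieldType) (j : {rmorphism ratfun K -> L}).
Local Notation q := #|K|.
Local Notation iota := (const_in j).
Local Notation ev u := (horner_morph (fun a => mulrC u (iota a))).
Local Notation t := (j (tvar K)).
Local Notation f := (map_poly j (pol72 K)).

Let q1 : (1 < q)%N := finNzRing_gt1 K.
Let qq : (q < q ^ 2)%N.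
Proof. by rewrite -[X in (X < _)%N]expn1 ltn_exp2l. Qed.

Let n_gt0 : (0 < q ^ 2 - 1)%N.
Proof. by rewrite subn_gt0 (ltn_trans q1). Qed.

Lemma map_pol72 : f = 'X^(q ^ 2 - 1) + t%:P * 'X^(q - 1) + 1.
Proof.
have map_trinomial (F : fieldType) (h : {rmorphism F -> L}) c m n :
    map_poly h ('X^m + c%:P * 'X^n + 1) = 'X^m + (h c)%:P * 'X^n + 1.
  by rewrite !rmorphD rmorphM rmorph1 /= !map_polyXn map_polyC.
exact: map_trinomial.
Qed.

Lemma size_map_pol72 : size f = (q ^ 2 - 1).+1.
Proof.
rewrite map_pol72 -addrA size_polyDl size_polyXn //.
rewrite ltnS; apply: leq_trans (size_polyD _ _) _.
rewrite size_poly1 geq_max n_gt0 andbT mul_polyC.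
apply: leq_trans (size_scale_leq _ _) _.
by rewrite size_polyXn ltn_sub2r // (ltn_trans q1).
Qed.

Lemma mulX_map_pol72 : 'X * f = 'X^(q ^ 2) + t%:P * 'X^q + 'X.
Proof.
rewrite map_pol72 !mulrDr mulr1 mulrCA -!exprS !subn1 !prednK ?expn_gt0 //.
  by rewrite ltnW.
by rewrite ltnW.
Qed.

Lemma root_map_pol72 (v : L) : root f v <-> v != 0 /\ dickson_root K t v.
Proof.
have fv : dickson K t v = v * f.[v].
  symmetry; transitivity ('X * f).[v]; first by rewrite !hornerE.
  by rewrite mulX_map_pol72 !hornerE /dickson -exprM.
have f0 : f.[0] = 1.
  rewrite map_pol72 !hornerE !expr0n !gtn_eqF ?n_gt0 ?subn_gt0 //.
  by rewrite mulr0 !add0r.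
rewrite /dickson_root fv rootE; split => [/eqP f0v|[v0 /eqP]].
  rewrite f0v mulr0; split=> //; apply: contra_eq_neq f0v => ->.
  by rewrite f0 oner_neq0.
by rewrite mulf_eq0 (negPf v0).
Qed.

(** In characteristic dividing q the derivative of X f is 1, so f + X f' = 1 is a Bezout
    relation. *)
Lemma separable_map_pol72 : separable_poly f.
Proof.
rewrite unlock; apply/Bezout_coprimepP; exists (1, 'X) => /=.
have <- : ('X * f)^`() = 1 * f + 'X * f^`() by rewrite derivM derivX.
have qX (p : {poly L}) : p *+ q = 0.
  by rewrite -mulr_natr -polyC_natr (natr_card iota) mulr0.
by rewrite mulX_map_pol72 !derivE -mulnn mulrnA !qX mulr0 !add0r eqpxx.
Qed.

Lemma moore1_roots (rs : seq L) : f %= \prod_(z <- rs) ('X - z%:P) ->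
  exists x y : L, [/\ root f x, dickson_root K t y & moore K x y = 1].
Proof.
move=> f_rs.
have rsP v : (v \in rs) = root f v by rewrite (eqp_root f_rs) root_prod_XsubC.
have U_rs : uniq rs.
  rewrite -separable_prod_XsubC -(eqp_separable f_rs).
  exact: separable_map_pol72.
have s_rs : size rs = (q ^ 2 - 1)%N.
  by apply: succn_inj; rewrite -size_map_pol72 (eqp_size f_rs) size_prod_XsubC.
have [x x_rs] : exists x, x \in rs.
  case: rs s_rs {f_rs rsP U_rs} => [e|x rs _]; first by move: n_gt0; rewrite -e.
  by exists x; apply: mem_head.
have fx : root f x by rewrite -rsP.
have [x0 tx] := (root_map_pol72 x).1 fx.
have [v v_rs xv] : exists2 v, v \in rs & moore K x v != 0.
  apply/hasP; apply: contraLR (leqnn (q ^ 2 - 1)) => /hasPn all0.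
  (* This is W(x, X), of degree q; it cannot vanish at all q^2 - 1 = (q - 1)(q + 1) > q roots of
     f. *)
  pose p : {poly L} := x *: 'X^q - (x ^+ q) *: 'X.
  have sp : size p = q.+1.
    rewrite size_polyDl size_scale // size_polyXn // size_polyN.
    by rewrite size_scale ?expf_neq0 // size_polyX.
  have p0 : p != 0 by rewrite -size_poly_eq0 sp.
  rewrite -ltnNge -{1}s_rs; apply: leq_trans (max_poly_roots p0 _ U_rs) _.
    apply/allP=> v /all0; rewrite negbK rootE /p !hornerE; exact.
  rewrite sp -[in X in (_ <= X)%N](exp1n 2) subn_sqr addn1 leq_pmull // subn_gt0 //.
have [/root_map_pol72[_ tv]] : root f v by rewrite -rsP.
have [c xvc] := moore_dickson iota tx tv.
have c0 : iota c != 0 by rewrite -xvc.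
(* Dividing v by c = W(x, v) normalizes the form; the zero term only gives the shape expected by the
   linearity lemmas. *)
exists x, (iota c^-1 * v + iota 0 * v); split => //.
  exact: dickson_root_lin.
rewrite moore_lin rmorph0 mul0r addr0 xvc -rmorphM mulVf ?rmorph1 //.
by rewrite -(fmorph_eq0 iota).
Qed.

Lemma root_pol72_tvar (x : L) : root f x ->
  t = - (x ^+ (q ^ 2 - 1) + 1) / x ^+ (q - 1).
Proof.
move=> fx; have [x0 _] := (root_map_pol72 x).1 fx.
have xq : x ^+ (q - 1) != 0 by rewrite expf_neq0.
move: fx; rewrite map_pol72 rootE !hornerE => /eqP fx.
apply: (canRL (mulfK xq)); apply/eqP; rewrite -addr_eq0; apply/eqP.
by rewrite -fx; ring.
Qed.

(** Since t is a rational function of x, an algebraic x would make t algebraic over F_q. *)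
Lemma root_pol72_transcendental (x : L) : root f x -> transcendental iota x.
Proof.
move=> fx; apply: not_algebraic_transcendental => x_alg.
suff : algebraicOver iota t.
  exact: (transcendental_not_algebraic (@tvar_transcendental _ _ j)).
have X_alg n : algebraicOver iota (x ^+ n).
  elim: n => [|n IH]; first by rewrite expr0; apply: algebraic1.
  by rewrite exprS; apply: algebraic_mul.
rewrite (root_pol72_tvar fx).
apply: algebraic_div => //; apply: algebraic_opp; apply: algebraic_add => //.
exact: algebraic1.
Qed.

Lemma root_pol72_size_ge (x : L) (p : {poly ratfun K}) : root f x ->
  p != 0 -> root (map_poly j p) x -> (size f <= size p)%N.
Proof.
move=> fx p0 px; rewrite size_map_pol72.
pose A : {poly K} := 'X^(q ^ 2 - 1) + 1; pose B : {poly K} := 'X^(q - 1).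
have sA : size A = (q ^ 2 - 1).+1.
  by rewrite size_polyDl size_polyXn // size_poly1 ltnS.
rewrite -sA; apply: (root_size_ge (B := B)) (root_pol72_transcendental fx) _ _ p0 px.
  (* [B] is a power of X, and A(0) = 1. *)
  apply: coprimep_expr; rewrite coprimepX rootE !hornerE expr0n gtn_eqF //.
  by rewrite add0r oner_eq0.
rewrite rmorphD rmorph1 !rmorphXn /= horner_morphX.
move: fx; rewrite map_pol72 rootE !hornerE => /eqP <-; ring.
Qed.

End TrinomialRoots.

(** * The Galois group *)

Lemma det_mx2 (R : comPzRingType) (A : 'M[R]_2) :
  \det A = A 0 0 * A 1 1 - A 0 1 * A 1 0.
Proof.
rewrite (expand_det_row _ 0) !big_ord_recl big_ord0 /cofactor !det_mx11 !mxE.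
rewrite /= expr0 expr1 mul1r mulN1r mulrN addr0.
by congr (_ * A _ _ - A _ _ * A _ _); apply: val_inj.
Qed.

Section GaloisGroup.

Variables (K : finFieldType) (L : splittingFieldType (ratfun K)).
Local Notation q := #|K|.
Local Notation j := (in_alg L : {rmorphism ratfun K -> L}).
Local Notation iota := (const_in j).
Local Notation ev u := (horner_morph (fun a => mulrC u (iota a))).
Local Notation t := (j (tvar K)).
Local Notation f := (map_poly j (pol72 K)).
Local Notation W := (@moore K L).
Local Notation G := 'Gal({:L} / 1%VS)%g.

Hypothesis splitL : splittingFieldFor 1%VS f {:L}.

Lemma galois_splitting : galois 1%VS {:L}.
Proof.
apply/splitting_galoisField; exists f; split=> //.
  exact: alg_polyOver.
exact: separable_map_pol72.
Qed.

Lemma gal_alg (s : gal_of {:L}) (e : ratfun K) : s (j e) = j e.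
Proof. by rewrite /= linearZ /= rmorph1. Qed.

Lemma gal_iota (s : gal_of {:L}) a : s (iota a) = iota a.
Proof. exact: gal_alg. Qed.

Lemma gal_semilinear (s : gal_of {:L}) u a v :
  s (u + iota a * v) = s u + iota a * s v.
Proof. by rewrite rmorphD rmorphM; congr (_ + _ * _); apply: gal_iota. Qed.

Lemma gal_moore (s : gal_of {:L}) u v : s (W u v) = W (s u) (s v).
Proof. by rewrite /moore rmorphB !rmorphM !rmorphXn. Qed.

Lemma gal_dickson (s : gal_of {:L}) v :
  dickson_root K t v -> dickson_root K t (s v).
Proof.
rewrite /dickson_root => tv; rewrite -(rmorph0 s) -tv /dickson.
rewrite !rmorphD rmorphM !rmorphXn; congr (_ + _ * _ + _).
exact/esym/gal_alg.
Qed.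

(** The minimal polynomial of x divides f and, by the degree bound, has the same degree, so v is a
    root of it too. *)
Lemma gal_transitive x v : root f x -> root f v ->
  exists2 s, s \in G & s x = v.
Proof.
move=> fx fv; apply: normalField_root_minPoly; rewrite ?sub1v ?memvf ?normalFieldf //.
suff e : minPoly 1 x %= f by rewrite (eqp_root e).
have dv : minPoly 1 x %| f by rewrite minPoly_dvdp ?alg_polyOver.
rewrite -dvdp_size_eqp // eqn_leq; apply/andP; split.
  by apply: dvdp_leq dv; rewrite -size_poly_eq0 size_map_pol72.
have /polyOver1P[p mp] := minPolyOver 1 x.
have p0 : p != 0.
  apply: contraTneq (monic_minPoly 1 x) => p0.
  by rewrite mp p0 rmorph0 monicE lead_coef0 eq_sym oner_neq0.
rewrite mp (size_map_poly _ p); apply: (root_pol72_size_ge fx p0).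
by rewrite -mp root_minPoly.
Qed.

(** * The Galois action in a basis of the plane of roots *)

Section Basis.

Variables (x y : L).
Hypotheses (fx : root f x) (ty : dickson_root K t y) (xy : W x y = 1).

Let x0 : x != 0. Proof. by case/root_map_pol72: fx. Qed.
Let tx : dickson_root K t x. Proof. by case/root_map_pol72: fx. Qed.

(** As s fixes x and W(x, y) = 1, the form W(x, s y - y) vanishes. *)
Lemma gal_fix_shift (s : gal_of {:L}) : s x = x ->
  exists a, s y = y + iota a * x.
Proof.
move=> sx; have [|a ea] := @moore_eq0 K L iota x (iota 1 * s y + iota (-1) * y) x0.
  by rewrite moore_lin xy -{1}sx -gal_moore xy rmorphN !rmorph1; ring.
by exists a; rewrite -ea rmorphN !rmorph1; ring.
Qed.

(** The group H of the overview: the stabilizer of x, recorded by its translations of y. *)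
Definition shifts : {set K} :=
  [set a | [exists s in 'Gal({:L} / <<1; x>>)%g, s y == y + iota a * x]].

Lemma shiftsP a : reflect (exists2 s, s \in 'Gal({:L} / <<1; x>>)%g &
  s y = y + iota a * x) (a \in shifts).
Proof.
rewrite inE; apply: (iffP exists_inP) => [[s ? /eqP]|[s ? /eqP]]; by exists s.
Qed.

Lemma gal_adjoin_fix (s : gal_of {:L}) : s \in 'Gal({:L} / <<1; x>>)%g -> s x = x.
Proof. by move/fixed_gal; apply; rewrite ?subvf ?memv_adjoin. Qed.

(** Automorphisms fixing x compose by adding their shifts, and inversion negates them. *)
Lemma shifts_zmod : zmod_closed shifts.
Proof.
split=> [|a b /shiftsP[s Gs sy] /shiftsP[r Gr ry]].
  by apply/shiftsP; exists 1%g; rewrite ?group1 // gal_id rmorph0 mul0r addr0.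
apply/shiftsP; exists (s * r^-1)%g; first by rewrite groupM ?groupV.
have GrV : (r^-1)%g \in 'Gal({:L} / <<1; x>>)%g by rewrite groupV.
have rVy : (r^-1)%g y = y + iota (- b) * x.
  have <- : (r * r^-1)%g (y + iota (- b) * x) = y + iota (- b) * x.
    by rewrite mulgV gal_id.
  rewrite galM ?memvf // (gal_semilinear r) ry (gal_adjoin_fix Gr).
  by rewrite rmorphN mulNr addrK.
rewrite galM ?memvf // sy gal_semilinear (gal_adjoin_fix GrV) rVy.
by rewrite rmorphN rmorphB; ring.
Qed.

Lemma shiftsT : shifts = setT.
Proof.
have x_tr := root_pol72_transcendental fx.
have u_tr : transcendental iota x^-1.
  apply: not_algebraic_transcendental => /algebraic_inv; rewrite invrK.
  exact: transcendental_not_algebraic.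
apply: (@artin_schreier_subgroup K L iota shifts x^-1 (y / x)) => //.
- exact: shifts_zmod.
- have xq : x ^+ q != 0 by rewrite expf_neq0.
  (* For z = y / x, z^q - z is the Moore determinant divided by x^(q+1). *)
  transitivity (W x y / x ^+ q.+1).
    by rewrite expr_div_n /moore exprS; field; rewrite x0 xq.
  by rewrite xy div1r exprVn.
set N := \prod_(a in shifts) _.
have x_rat : rational_in iota x^-1 x.
  rewrite -{2}[x]invrK; apply: rational_inV.
  by exists 'X, 1; rewrite rmorph1 oner_neq0 divr1 horner_morphX.
have t_rat : rational_in iota x^-1 t.
  rewrite (root_pol72_tvar fx).
  pose A : {poly K} := - ('X^(q ^ 2 - 1) + 1).
  have <- : ev x A = - (x ^+ (q ^ 2 - 1) + 1).
    by rewrite rmorphN rmorphD rmorph1 rmorphXn /= horner_morphX.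
  have <- : ev x 'X^(q - 1) = x ^+ (q - 1) by rewrite rmorphXn /= horner_morphX.
  by apply: rational_inM; last apply: rational_inV; apply: rational_in_comp.
(* Each s fixing F(x) adds some b in H to y / x, which permutes the factors of N; Galois descent
   puts N in F(x), and t in F_q(1/x) makes it rational in 1/x. *)
have : N \in <<1; x>>%VS.
  have /galois_fixedField <- : galois <<1; x>> {:L}.
    by apply: galoisS galois_splitting; rewrite sub1v subvf.
  apply/fixedFieldP => [|s Gs]; first exact: memvf.
  have [b sy] := gal_fix_shift (gal_adjoin_fix Gs).
  have Hb : b \in shifts by apply/shiftsP; exists s.
  rewrite rmorph_prod -[RHS](subgroup_prod_translate iota shifts_zmod _ Hb).
  apply: eq_bigr => a _.
  transitivity (s y / s x - s (iota a)); first by rewrite rmorphB fmorph_div.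
  by rewrite sy (gal_adjoin_fix Gs) gal_iota mulrDl mulfK.
case/Fadjoin1_polyP=> p ->; apply: rational_in_horner => // i.
by rewrite coef_map; apply: rational_in_ratfun.
Qed.

Lemma gal_lin (s : gal_of {:L}) a u b v :
  s (iota a * u + iota b * v) = iota a * s u + iota b * s v.
Proof.
by rewrite gal_semilinear rmorphM; congr (_ * _ + _); apply: gal_iota.
Qed.

(* The images of x and y are the rows of g: a Galois product s * r applies s
   first, so this is the convention under which s |-> g is multiplicative. *)
Definition acts_by (s : gal_of {:L}) (g : {'GL_2[K]}) : bool :=
  (s x == iota (GLval g 0 0) * x + iota (GLval g 0 1) * y) &&
  (s y == iota (GLval g 1 0) * x + iota (GLval g 1 1) * y).

Lemma acts_by_det s g : acts_by s g -> \det (GLval g) = 1.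
Proof.
move=> /andP[/eqP sx /eqP sy]; apply: (fmorph_inj iota).
transitivity (s (W x y)); last by rewrite xy !rmorph1.
by rewrite gal_moore sx sy moore_det xy mulr1 det_mx2.
Qed.

Lemma acts_by_exists s : exists g, acts_by s g.
Proof.
have [a [b sx]] := dickson_span iota xy tx ty (gal_dickson s tx).
have [c [d sy]] := dickson_span iota xy tx ty (gal_dickson s ty).
pose A : 'M[K]_2 := \matrix_(i, k)
  (if i == 0 then if k == 0 then a else b else if k == 0 then c else d).
have A_unit : A \is a GRing.unit.
  have : iota (\det A) = 1.
    transitivity (s (W x y)); last by rewrite xy rmorph1.
    by rewrite gal_moore sx sy moore_det xy mulr1 det_mx2 !mxE.
  rewrite -(rmorph1 iota) => /fmorph_inj dA.
  by rewrite -[_ \is a _]/(A \in unitmx) unitmxE dA unitr1.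
exists (FinRing.unit _ A_unit).
by rewrite /acts_by /= !mxE /= sx sy !eqxx.
Qed.

Lemma acts_by_inj s g h : acts_by s g -> acts_by s h -> g = h.
Proof.
move=> /andP[/eqP sx /eqP sy] /andP[]; rewrite sx sy.
move=> /eqP/(moore_coord_inj xy)[e00 e01] /eqP/(moore_coord_inj xy)[e10 e11].
apply/val_inj/matrixP => i k /=.
have I2 (l : 'I_2) : l = 0 \/ l = 1.
  by case: l => [[|[|]]] // ?; [left | right]; apply: val_inj.
by case: (I2 i) => ->; case: (I2 k) => ->.
Qed.

Lemma acts_byM s r g h : acts_by s g -> acts_by r h -> acts_by (s * r)%g (g * h)%g.
Proof.
move=> /andP[/eqP sx /eqP sy] /andP[/eqP rx /eqP ry].
rewrite /acts_by !galM ?memvf // sx sy !gal_lin rx ry GL_MxE !mxE.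
rewrite !big_ord_recl !big_ord0 !addr0.
have -> : lift ord0 ord0 = 1 :> 'I_2 by apply: val_inj.
by rewrite !rmorphD !rmorphM; apply/andP; split; apply/eqP; ring.
Qed.

(** Fixing x and y, s fixes their span, which contains all roots of f, and these generate [L]. *)
Lemma acts_by1 s : acts_by s 1%g -> s = 1%g.
Proof.
rewrite /acts_by GL_1E !mxE => /andP[/eqP s_x /eqP s_y].
have sx : s x = x.
  transitivity (iota 1 * x + iota 0 * y); first exact: s_x.
  by rewrite rmorph1 rmorph0 mul1r mul0r addr0.
have sy : s y = y.
  transitivity (iota 0 * x + iota 1 * y); first exact: s_y.
  by rewrite rmorph1 rmorph0 mul1r mul0r add0r.
have [rs f_rs Lrs] := splitL.
have subL : (<<1 & rs>> <= fixedField [set s])%VS.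
  apply/Fadjoin_seqP; split=> [|v v_rs]; first exact: sub1v.
  have /root_map_pol72[_ tv] : root f v by rewrite (eqp_root f_rs) root_prod_XsubC.
  have [a [b ->]] := dickson_span iota xy tx ty tv.
  apply/fixedFieldP=> [|r]; first exact: memvf.
  by rewrite inE => /eqP->; rewrite gal_lin sx sy.
apply/eqP/gal_eqP => v _; rewrite gal_id.
have v_rs : v \in <<1 & rs>>%VS by rewrite Lrs memvf.
by have /mem_fixedFieldP[_] := subvP subL v v_rs; apply; rewrite inE.
Qed.

(** Transitivity gives s with s x = v. Both w and s y pair to 1 with v, so w = s y + e v, and
    applying the transvection r : y |-> y + e x before s corrects the image of y. *)
Lemma acts_by_surj g : \det (GLval g) = 1 -> exists2 s, s \in G & acts_by s g.
Proof.
rewrite det_mx2; set a := GLval g 0 0; set b := GLval g 0 1.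
set c := GLval g 1 0; set d := GLval g 1 1 => dg.
pose v := iota a * x + iota b * y; pose w := iota c * x + iota d * y.
have vw : W v w = 1 by rewrite moore_det xy dg rmorph1 mulr1.
have v0 := moore1_neq0 vw.
have [s Gs sx] : exists2 s, s \in G & s x = v.
  apply: gal_transitive => //; apply/root_map_pol72; split=> //.
  exact: dickson_root_lin.
have [|e we] := @moore_eq0 K L iota v (iota 1 * w + iota (- 1) * s y) v0.
  by rewrite moore_lin vw -{1}sx -gal_moore xy rmorphN !rmorph1; ring.
have /shiftsP[r Gr ry] : e \in shifts by rewrite shiftsT inE.
exists (r * s)%g; first by rewrite groupM // (subsetP (galS _ (sub1v _)) _ Gr).
rewrite /acts_by !galM ?memvf // (gal_adjoin_fix Gr) ry gal_semilinear sx eqxx /=.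
by apply/eqP; rewrite -/c -/d -/w -we rmorphN !rmorph1; ring.
Qed.

(** The default [1%g] is never taken, since every s has a matrix. *)
Definition gal_mx s : {'GL_2[K]} := odflt 1%g [pick g | acts_by s g].

Lemma gal_mxP s : acts_by s (gal_mx s).
Proof.
rewrite /gal_mx; case: pickP => //= none.
by have [g sg] := acts_by_exists s; rewrite none in sg.
Qed.

Lemma gal_mxM : {in G &, {morph gal_mx : s r / (s * r)%g}}.
Proof.
by move=> s r _ _; apply: acts_by_inj (gal_mxP _) _; apply: acts_byM; apply: gal_mxP.
Qed.

Lemma isog_SL2 : (G \isog SL2 K)%g.
Proof.
pose phi := Morphism gal_mxM.
have inj_phi : ('injm phi)%g.
  apply/subsetP => s /morphpreP[_ /set1P phi1]; apply/set1P/acts_by1.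
  by rewrite -phi1; apply: gal_mxP.
have <- : (phi @* G = SL2 K)%g.
  apply/setP=> g; apply/morphimP/idP => [[s _ _ ->]|].
    by rewrite inE; apply/eqP/acts_by_det/gal_mxP.
  rewrite inE => /eqP/acts_by_surj[s Gs sg]; exists s => //.
  exact: acts_by_inj sg (gal_mxP s).
exact: sub_isog.
Qed.

End Basis.
End GaloisGroup.

Theorem theorem7p2 (K : finFieldType) (L : splittingFieldType (ratfun K)) :
  splittingFieldFor 1%VS (map_poly (GRing.in_alg L) (pol72 K)) {:L} ->
  ('Gal({:L} / 1%VS) \isog SL2 K)%g.
Proof.
move=> splitL; have [rs f_rs _] := splitL.
have [x [y [fx ty xy]]] := moore1_roots f_rs.
exact: isog_SL2 splitL _ _ fx ty xy.
Qed.
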